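(* Let $d\ge1$, let $S_d$ be the star graph with center $x_1$ and $d$ leaves $x_2,\dots,x_{d+1}$, and let $\tilde S_d$ be its suspension with suspension vertex $x_{d+2}$. Then a magnetic potential on $\tilde S_d$ is maximal if and only if it is gauge equivalent to a potential $\tilde\sigma$ satisfying $$\tilde\sigma(x_1,x_j)=1\quad\text{for }j=2,\dots,d+1,$$ and $$\tilde\sigma(x_j,x_{d+2})=a_j\in S^1\quad\text{for }j=1,\dots,d+1,$$ with $$\sum_{j=1}^{d+1}a_j=0.$$ In particular, if $d\ge3$, $\tilde S_d$ has uncountably many pairwise non gauge equivalent maximal potentials.
   Context: All graphs $G=(V,E)$ are finite and simple; $x\sim y$ denotes adjacency. $E^{or}(G)$ is the set of ordered pairs $(x,y)$ with $x\sim y$. A magnetic potential is a map $\sigma:E^{or}(G)\to S^1=\{z\in\mathbb{C}:|z|=1\}$ with $\sigma(y,x)=\sigma(x,y)^{-1}$. The magnetic Laplacian on functions $f:V\to\mathbb{C}$ is $\Delta^\sigma f(x)=\sum_{y\sim x}(f(x)-\sigma(x,y)f(y))$, and $\lambda_1^\sigma(G)$ is its smallest eigenvalue. The magneto-spectral height is $\nu(G)=\sup_\sigma\lambda_1^\sigma(G)$, over all magnetic potentials; $\sigma$ is maximal if $\lambda_1^\sigma(G)=\nu(G)$. Two magnetic potentials $\sigma_1,\sigma_2$ are gauge equivalent if there is $\tau:V\to S^1$ with $\sigma_2(x,y)=\tau(x)^{-1}\sigma_1(x,y)\tau(y)$ for all $(x,y)\in E^{or}(G)$. The suspension of a graph is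 obtained by adding one new vertex (the suspension vertex) connected to all its vertices. *)

(* Defs.v *)
From HB Require Import structures.
From mathcomp Require Import all_boot all_order all_algebra.
From mathcomp Require Import all_classical reals.
From mathcomp Require Import complex.

Set Implicit Arguments.
Unset Strict Implicit.
Unset Printing Implicit Defensive.

Import Order.TTheory GRing.Theory Num.Theory.
Local Open Scope ring_scope.
Local Open Scope classical_set_scope.
Local Open Scope complex_scope.

Record sgraph := SGraph {
  vertex :> finType;
  adj : rel vertex;
  adj_sym : symmetric adj;
  adj_irr : irreflexive adj }.

Definition star_adj (d : nat) : rel 'I_d.+1 :=
  fun i j => (i == ord0) (+) (j == ord0).

Lemma star_adj_sym d : symmetric (@star_adj d).
Proof. by move=> i j; rewrite /star_adj addbC. Qed.

Lemma star_adj_irr d : irreflexive (@star_adj d).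
Proof. by move=> i; rewrite /star_adj addbb. Qed.

(* The center is [ord0]; the leaves are the [lift ord0 j] for [j : 'I_d]. *)
Definition star (d : nat) : sgraph :=
  SGraph (@star_adj_sym d) (@star_adj_irr d).

Definition suspension_adj (G : sgraph) : rel (option G) :=
  fun x y => match x, y with
             | Some u, Some v => adj u v
             | None, None => false
             | _, _ => true
             end.

Lemma suspension_adj_sym G : symmetric (@suspension_adj G).
Proof. by move=> [x|] [y|] //=; rewrite adj_sym. Qed.

Lemma suspension_adj_irr G : irreflexive (@suspension_adj G).
Proof. by move=> [x|] //=; rewrite adj_irr. Qed.

(* [None] is the suspension vertex. *)
Definition suspension (G : sgraph) : sgraph :=
  SGraph (@suspension_adj_sym G) (@suspension_adj_irr G).

Section Magnetic.
Variables (R : realType) (G : sgraph).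

(* A potential is only meaningful on adjacent pairs: its values elsewhere are
   unconstrained, and nothing below depends on them. *)
Definition magnetic_potential (s : G -> G -> R[i]) : Prop :=
  forall x y : G, adj x y -> `|s x y| = 1 /\ s y x = (s x y)^-1.

Definition magnetic_laplacian (s : G -> G -> R[i]) (f : G -> R[i]) (x : G)
    : R[i] :=
  \sum_(y | adj x y) (f x - s x y * f y).

Definition magnetic_eigenvalue (s : G -> G -> R[i]) (l : R[i]) : Prop :=
  exists f : G -> R[i],
    (exists x, f x <> 0) /\ forall x, magnetic_laplacian s f x = l * f x.

(* In the order of [R[i]], [l%:C <= m] means that [m] is real and [l <= m]; the
   Laplacian of a potential being Hermitian, all its eigenvalues are real and
   exactly one [l] is the smallest when [G] has a vertex. *)
Definition is_lambda1 (s : G -> G -> R[i]) (l : R) : Prop :=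
  magnetic_eigenvalue s l%:C /\
  forall m : R[i], magnetic_eigenvalue s m -> l%:C <= m.

Definition magneto_spectral_height : R :=
  sup [set l : R | exists2 s, magnetic_potential s & is_lambda1 s l].

Definition maximal_potential (s : G -> G -> R[i]) : Prop :=
  magnetic_potential s /\ is_lambda1 s magneto_spectral_height.

Definition gauge_equivalent (s1 s2 : G -> G -> R[i]) : Prop :=
  exists t : G -> R[i],
    (forall x, `|t x| = 1) /\
    forall x y, adj x y -> s2 x y = (t x)^-1 * s1 x y * t y.

End Magnetic.

(* Main.v *)
Require Import Defs.
From HB Require Import structures.
From mathcomp Require Import all_boot all_order all_algebra.
From mathcomp Require Import all_classical reals.
From mathcomp Require Import complex.
From mathcomp Require Import ring lra.
From mathcomp Require Import lebesgue_measure ereal.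

Set Implicit Arguments.
Unset Strict Implicit.
Unset Printing Implicit Defensive.

Import Order.TTheory GRing.Theory Num.Theory.
Local Open Scope ring_scope.
Local Open Scope classical_set_scope.
Local Open Scope complex_scope.

(** The star is a tree, so a gauge transformation makes all its edges carry the
    value 1; a potential on the suspension is then described by the values
    [a j] on the edges to the apex ([star_gauge a], [star_gauge_normal_form]).
    Write S for the sum of all the [a j], and u, v, w_j for the values of f at
    the center, the apex and the leaves.  Everything rests on the identity
      <Delta f, f> - <f, f>
        = \sum_j |w_j - u - a_j v|^2 - 2 Re (u^* v S),
    with j ranging over the leaves.

    If S = 0, the right-hand side is nonnegative, and it vanishes for instance
    at v = 0, u = w_j = 1; so the smallest eigenvalue is exactly 1
    ([balanced_lambda1]).

    If S != 0, there is an eigenvalue below 1 ([unbalanced_eigenvalue]).  It is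
    found explicitly: for an eigenvalue 2 - y with y != 0, the equations at the
    leaves give w_j = (u + a_j v) / y, and what remains is a 2 x 2 Hermitian
    system in (u, v), singular exactly when
      ((y - 1) (y + d))^2 = |a_0 y + \sum_(leaves) a_j|^2.
    At y = 1 the left-hand side is 0 and the right-hand side |S|^2 > 0; at
    y = 2 the left-hand side is (d + 2)^2, which bounds the right-hand side by
    the triangle inequality.  Hence a solution with 1 < y <= 2.

    There are d + 1 >= 2 unit numbers with sum 0 (powers of a root of
    1 + X + ... + X^d), so the magneto-spectral height is 1
    ([height_suspended_star]) and the maximal potentials are those with S = 0.

    The gauge class of [star_gauge a] determines a up to one common factor
    ([star_gauge_rigid]).  When d >= 3, the numbers 1, -1, z b_0, z b_1, ...,
    with b_0 = 1 and the b_i of sum 0, form for each unit z a balanced family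
    with first entry 1, so distinct z give inequivalent maximal potentials. *)

(** * Unit complex numbers *)

Section UnitComplex.
Variable R : realType.
Implicit Types x y z : R[i].

Lemma unit_neq0 x : `|x| = 1 -> x != 0.
Proof. by move=> x1; rewrite -normr_eq0 x1 oner_eq0. Qed.

Lemma unit_conjE x : `|x| = 1 -> x^* = x^-1.
Proof.
move=> x1; apply: (mulfI (unit_neq0 x1)).
by rewrite -sqr_normc x1 expr1n divff ?unit_neq0.
Qed.

Lemma unit_root1 z n : (0 < n)%N -> z ^+ n = 1 -> `|z| = 1.
Proof.
move=> n0 zn; apply/eqP; rewrite -(@pexpr_eq1 _ _ n) //.
by rewrite -normrX zn normr1.
Qed.

(** The powers of a root of 1 + X + ... + X^(n-1): such a root z satisfies
    z^n = 1, hence has modulus 1. *)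
Lemma unit_sum0_exists n : (1 < n)%N ->
  exists2 b : 'I_n -> R[i], (forall j, `|b j| = 1) &
    \sum_j b j = 0 /\ forall j, val j = 0%N -> b j = 1.
Proof.
case: n => [|[|n]] // _.
have szp : size (\poly_(i < n.+2) (1 : R[i])) = n.+2.
  by rewrite size_poly_eq ?oner_eq0.
have [z] : exists z, root (\poly_(i < n.+2) (1 : R[i])) z.
  by apply/closed_rootP; rewrite szp.
rewrite /root horner_poly => /eqP z0.
have zs : \sum_(i < n.+2) z ^+ i = 0.
  by rewrite -[RHS]z0; apply: eq_bigr => i _; rewrite mul1r.
have zn : z ^+ n.+2 = 1.
  by apply/eqP; rewrite -subr_eq0 subrX1 zs mulr0.
exists (fun i => z ^+ i) => [j|].
  by rewrite normrX (unit_root1 _ zn) // expr1n.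
by split=> // j /= ->; rewrite expr0.
Qed.

End UnitComplex.

(** * Gauge invariance of the spectrum *)

Section Gauge.
Variables (R : realType) (G : sgraph).
Implicit Types s t : G -> G -> R[i].

Lemma gauge_equivalent_sym s t : gauge_equivalent s t -> gauge_equivalent t s.
Proof.
move=> [tau [tau1 ts]]; exists (fun x => (tau x)^-1).
split=> [x|x y xy]; first by rewrite normfV tau1 invr1.
rewrite (ts _ _ xy); have x0 := unit_neq0 (tau1 x).
by have y0 := unit_neq0 (tau1 y); field; rewrite x0 y0.
Qed.

Lemma gauge_equivalent_trans s t r :
  gauge_equivalent s t -> gauge_equivalent t r -> gauge_equivalent s r.
Proof.
move=> [tau [tau1 ts]] [ups [ups1 rt]]; exists (fun x => tau x * ups x).
split=> [x|x y xy]; first by rewrite normrM tau1 ups1 mulr1.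
rewrite (rt _ _ xy) (ts _ _ xy) invfM; ring.
Qed.

Lemma gauge_eigenvalue s t l :
  gauge_equivalent s t -> magnetic_eigenvalue s l -> magnetic_eigenvalue t l.
Proof.
move=> [tau [tau1 ts]] [f [[x0 fx0] ef]].
exists (fun x => (tau x)^-1 * f x); split.
  exists x0; apply/eqP; rewrite mulf_eq0 invr_eq0 (negbTE (unit_neq0 _)) //=.
  exact/eqP.
move=> x; have tx := unit_neq0 (tau1 x).
rewrite mulrCA -ef /magnetic_laplacian mulr_sumr; apply: eq_bigr => y xy.
by rewrite (ts _ _ xy); have ty := unit_neq0 (tau1 y); field; rewrite tx ty.
Qed.

Lemma gauge_lambda1 s t l :
  gauge_equivalent s t -> is_lambda1 s l -> is_lambda1 t l.
Proof.
move=> st [es ms]; split; first exact: gauge_eigenvalue es.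
by move=> m /(gauge_eigenvalue (gauge_equivalent_sym st)); exact: ms.
Qed.

End Gauge.

(** * Potentials on the suspended star *)

Section SuspendedStar.
Variables (R : realType) (d : nat).
Local Notation V := (suspension (star d)).
Implicit Types (a : 'I_d.+1 -> R[i]) (f : V -> R[i]) (s : V -> V -> R[i]).

Local Notation center := (Some ord0 : V).
Local Notation leaf j := (Some (lift ord0 j) : V).
Local Notation apex := (None : V).

Definition star_gauge a : V -> V -> R[i] := fun x y =>
  match x, y with
  | Some j, None => a j
  | None, Some j => (a j)^-1
  | _, _ => 1
  end.

Lemma star_gauge_potential a :
  (forall j, `|a j| = 1) -> magnetic_potential (star_gauge a).
Proof.
move=> a1 [i|] [j|] //= _; rewrite ?normr1 ?invr1 ?invrK ?normfV ?a1 ?invr1 //.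
Qed.

Lemma sum_suspension (P : pred V) (F : V -> R[i]) :
  \sum_(y | P y) F y =
  (if P apex then F apex else 0) + (if P center then F center else 0)
    + \sum_(j < d) if P (leaf j) then F (leaf j) else 0.
Proof.
rewrite big_mkcond (bigD1 apex) //= -addrA; congr (_ + _).
rewrite (@reindex_omap _ _ _ V 'I_d.+1 Some id) /=; last by case.
rewrite (eq_bigl xpredT) => [|i]; last by rewrite eqxx.
by rewrite big_ord_recl.
Qed.

Lemma laplacian_center a f : magnetic_laplacian (star_gauge a) f center =
  (f center - a ord0 * f apex) + \sum_(j < d) (f center - f (leaf j)).
Proof.
rewrite /magnetic_laplacian sum_suspension /= addr0; congr (_ + _).
by apply: eq_bigr => j _; rewrite mul1r.
Qed.

Lemma laplacian_leaf a f j : magnetic_laplacian (star_gauge a) f (leaf j) =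
  (f (leaf j) - a (lift ord0 j) * f apex) + (f (leaf j) - f center).
Proof.
by rewrite /magnetic_laplacian sum_suspension /= mul1r big1 ?addr0.
Qed.

Lemma laplacian_apex a f : magnetic_laplacian (star_gauge a) f apex =
  (f apex - (a ord0)^-1 * f center)
    + \sum_(j < d) (f apex - (a (lift ord0 j))^-1 * f (leaf j)).
Proof. by rewrite /magnetic_laplacian sum_suspension /= add0r. Qed.

(** Any potential on a tree is trivial up to gauge; here the gauge transports
    the value 1 from the center along the edges of the star. *)
Lemma star_gauge_normal_form s : magnetic_potential s ->
  exists2 a, (forall j, `|a j| = 1) & gauge_equivalent s (star_gauge a).
Proof.
move=> hs.
pose tau (x : V) : R[i] :=
  if x is Some i then (if i == ord0 then 1 else s (Some i) center) else 1.
have tau1 x : `|tau x| = 1.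
  case: x => [i|] /=; last by rewrite normr1.
  case: eqP => [|/eqP i0]; first by rewrite normr1.
  have /hs[] // : adj (Some i : V) center.
  by rewrite /= /star_adj eqxx (negbTE i0).
exists (fun j => (tau (Some j))^-1 * s (Some j) apex).
  move=> j; have /hs[sj _] : adj (Some j : V) apex by [].
  by rewrite normrM normfV tau1 sj invr1 mulr1.
exists tau; split=> // -[i|] [j|] // xy; last 2 first.
- by rewrite mulr1.
- by have [_ /= ->] := hs (Some j) None isT; rewrite invr1 mul1r invfM invrK mulrC.
have [n1 sji] := hs _ _ xy.
move: (xy) => /=; rewrite /star_adj; case: eqP => [i0|/eqP i0];
  case: eqP => [j0|/eqP j0] //= _.
- by rewrite invr1 mul1r -i0 sji divff // unit_neq0.
- by rewrite mulr1 -j0 mulVf ?(unit_neq0 n1).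
Qed.

(** * Balanced potentials have smallest eigenvalue 1 *)

Section Balanced.
Variable a : 'I_d.+1 -> R[i].
Hypothesis a1 : forall j, `|a j| = 1.
Hypothesis a_sum0 : \sum_j a j = 0.

(** When the [a j] sum to 0, the operator [Delta - 1] factors through these
    numbers: by the three lemmas below it is [D^* D], where [D f] is the family
    [defect f] indexed by the leaves. *)
Let defect f j := f (leaf j) - f center - a (lift ord0 j) * f apex.

Lemma balanced_leaf f j :
  magnetic_laplacian (star_gauge a) f (leaf j) = f (leaf j) + defect f j.
Proof. by rewrite laplacian_leaf /defect; ring. Qed.

Lemma balanced_center f :
  magnetic_laplacian (star_gauge a) f center = f center - \sum_j defect f j.
Proof.
rewrite laplacian_center /defect.
have /eqP : \sum_j a j = 0 by []; rewrite big_ord_recl addr_eq0 => /eqP ->.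
by rewrite !sumrB -mulr_suml; ring.
Qed.

Lemma balanced_apex f : magnetic_laplacian (star_gauge a) f apex =
  f apex - \sum_j (a (lift ord0 j))^-1 * defect f j.
Proof.
have /eqP : \sum_j (a j)^-1 = 0.
  (* The inverses of the a j are their conjugates. *)
  transitivity ((\sum_j a j)^*); last by rewrite a_sum0 conjc0.
  by rewrite rmorph_sum; apply: eq_bigr => j _; rewrite /= unit_conjE.
rewrite big_ord_recl addr_eq0 laplacian_apex => /eqP ->.
have -> : \sum_j (a (lift ord0 j))^-1 * defect f j =
    \sum_j ((a (lift ord0 j))^-1 * f (leaf j) - (a (lift ord0 j))^-1 * f center
            - f apex).
  apply: eq_bigr => j _; rewrite /defect.
  by have aj := unit_neq0 (a1 (lift ord0 j)); field.
by rewrite !sumrB -mulr_suml; ring.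
Qed.

(** Pairing an eigenvector equation for m with f gives
    (m - 1) |f|^2 = \sum_j |defect f j|^2, which forces m - 1 to
    be real and nonnegative. *)
Lemma balanced_lambda1 : is_lambda1 (star_gauge a) 1.
Proof.
split.
  exists (fun x : V => if x is Some _ then 1 else 0).
  split; first by exists center; apply/eqP; exact: oner_neq0.
  set f := fun x : V => _; have g0 j : defect f j = 0.
    by rewrite /defect /f /= mulr0 !subr0 subrr.
  case=> [i|]; rewrite mul1r.
    have [j ->|->] := unliftP ord0 i; first by rewrite balanced_leaf g0 addr0.
    by rewrite balanced_center big1 ?subr0.
  by rewrite balanced_apex big1 ?subr0 // => j _; rewrite g0 mulr0.
move=> m [f [[x0 /eqP fx0] ef]].
pose nrm := `|f center| ^+ 2 + `|f apex| ^+ 2 + \sum_(j < d) `|f (leaf j)| ^+ 2.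
have nrm_ge0 : 0 <= nrm by rewrite !addr_ge0 ?sumr_ge0 // => *; rewrite exprn_ge0.
have nrm_neq0 : nrm != 0.
  apply: contra fx0; rewrite paddr_eq0; last 2 first.
  - by rewrite addr_ge0 ?exprn_ge0.
  - by rewrite sumr_ge0 // => *; rewrite exprn_ge0.
  rewrite paddr_eq0 ?exprn_ge0 // !expf_eq0 /= !normr_eq0.
  move=> /andP[/andP[fc fa]]; rewrite psumr_eq0; last first.
    by move=> *; rewrite exprn_ge0.
  move=> /allP fl; case: x0 => [i|//].
  have [j ->|->] := unliftP ord0 i; last by [].
  by have := fl j; rewrite mem_index_enum expf_eq0 /= normr_eq0; apply.
have gl j : (m - 1) * f (leaf j) = defect f j.
  by rewrite mulrBl mul1r -ef balanced_leaf addrAC subrr add0r.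
have gc : (m - 1) * f center = - \sum_j defect f j.
  by rewrite mulrBl mul1r -ef balanced_center addrAC subrr add0r.
have ga : (m - 1) * f apex = - \sum_j (a (lift ord0 j))^-1 * defect f j.
  by rewrite mulrBl mul1r -ef balanced_apex addrAC subrr add0r.
have key : (m - 1) * nrm = \sum_(j < d) `|defect f j| ^+ 2.
  rewrite /nrm 2!mulrDr !sqr_normc !mulrA gc ga mulr_sumr.
  rewrite !mulNr !mulr_suml -!sumrN -!big_split /=; apply: eq_bigr => j _.
  rewrite !sqr_normc mulrA gl.
  have -> : (defect f j)^* = (f (leaf j))^* - (f center)^*
      - (a (lift ord0 j))^-1 * (f apex)^*.
    by rewrite /defect !rmorphB rmorphM /= (unit_conjE (a1 _)).
  by ring.
have nrm_gt0 : 0 < nrm by rewrite lt0r nrm_neq0.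
rewrite -subr_ge0 -(pmulr_lge0 _ nrm_gt0) key.
by rewrite sumr_ge0 // => *; rewrite exprn_ge0.
Qed.

End Balanced.

(** * Unbalanced potentials have an eigenvalue below 1 *)

(** The eigenvalue equation for 2 - y at the center, and at the apex after
    exchanging the roles of u and v, once the leaf values (u + a_j v) / y have
    been substituted; s is the sum of the coefficients on the leaves. *)
Lemma eliminate_leaves (F : fieldType) (n : nat) (y u v b s : F) : y != 0 ->
  (y - 1) * (y + n%:R) * u = (b * y + s) * v ->
  (u - b * v) + (u *+ n - (u *+ n + s * v) / y) = (2 - y) * u.
Proof.
move=> y0 e; apply/eqP; rewrite -subr_eq0; apply/eqP.
rewrite -[u *+ n]mulr_natr.
transitivity (((y - 1) * (y + n%:R) * u - (b * y + s) * v) / y); first by field.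
by rewrite e subrr mul0r.
Qed.

Lemma unbalanced_eigenvalue a : (forall j, `|a j| = 1) -> \sum_j a j != 0 ->
  exists2 l : R, l < 1 & magnetic_eigenvalue (star_gauge a) l%:C.
Proof.
move=> a1 S0.
(* [A y] and [B y] are the entries of the 2 x 2 system left at the center and
   the apex, and [p.[y]] is its determinant. *)
pose S : R[i] := \sum_j a (lift ord0 j); pose B (y : R) : R[i] := a ord0 * y%:C + S.
pose A (y : R) : R := (y - 1) * (y + d%:R).
pose p : {poly R} := (('X - 1) * ('X + d%:R%:P)) ^+ 2
  - ((complex.Re (a ord0))%:P * 'X + (complex.Re S)%:P) ^+ 2
  - ((complex.Im (a ord0))%:P * 'X + (complex.Im S)%:P) ^+ 2.
have pE y : (p.[y])%:C = (A y)%:C ^+ 2 - `|B y| ^+ 2.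
  rewrite -add_Re2_Im2 -rmorphXn -rmorphB /= /p !hornerE /B /A.
  by case: (a ord0) (S) => [x1 x2] [s1 s2] /=; congr (_%:C); ring.
have p1 : p.[1] < 0.
  rewrite -ltcR pE /A subrr mul0r rmorph0 expr0n sub0r oppr_lt0.
  rewrite exprn_gt0 // normr_gt0 /B mulr1; apply: contra S0.
  by rewrite big_ord_recl.
have p2 : 0 <= p.[2].
  rewrite -lecR pE subr_ge0; have -> : A 2 = d.+2%:R by rewrite /A -!natr1; ring.
  rewrite rmorph_nat lerXn2r ?nnegrE ?ler0n //.
  apply: le_trans (ler_normD _ _) _; rewrite normrM a1 mul1r.
  rewrite -[d.+2]/(2 + d)%N natrD lerD //.
    by rewrite rmorph_nat normr_nat.
  apply: le_trans (ler_norm_sum _ _ _) _.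
  by rewrite (eq_bigr (fun=> 1)) // sumr_const card_ord.
have [||y /andP[y1 _] /rootP py] := @poly_ivt R p 1 2; first by rewrite ler1n.
  by rewrite p2 ltW.
have yN1 : y != 1 by apply: contraTneq p1 => <-; rewrite py ltxx.
have {yN1} y1 : 1 < y by rewrite lt_neqAle eq_sym yN1.
have AB : (A y)%:C * (A y)%:C = B y * (B y)^*.
  by apply/eqP; rewrite -sqr_normc -expr2 -subr_eq0 -pE py.
have [u [v [uv0 [eu ev]]]] : exists u v : R[i], [/\ (u != 0) || (v != 0) &
    (A y)%:C * u = B y * v /\ (A y)%:C * v = (B y)^* * u].
  (* The kernel vector (B, A) is zero when B, hence A, vanishes; any vector
     then serves. *)
  have [B0|B0] := eqVneq (B y) 0.
    exists 1, 0; rewrite oner_neq0 B0 mulr0 rmorph0 mul0r !mulr0; split=> //.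
    move/eqP: AB; rewrite B0 mul0r mulf_eq0 orbb => /eqP ->.
    by rewrite mul0r.
  exists (B y), (A y)%:C; rewrite B0 AB; split=> //; split.
    by rewrite mulrC.
  by rewrite mulrC.
have yC0 : y%:C != 0.
  by rewrite (eq_complex y%:C) /= eqxx andbT gt_eqF // (lt_trans ltr01).
have AE : (A y)%:C = (y%:C - 1) * (y%:C + d%:R).
  by rewrite /A rmorphM rmorphB rmorphD rmorph1 rmorph_nat.
exists (2 - y); first by rewrite ltrBlDr; lra.
rewrite rmorphB rmorph_nat.
pose f : V -> R[i] := fun x => match x with
  | None => v
  | Some i => if i == ord0 then u else (u + a i * v) / y%:C
  end.
have fl j : f (leaf j) = (u + a (lift ord0 j) * v) / y%:C by [].
exists f; split.
  have [u0|v0] := orP uv0; first by exists center; apply/eqP.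
  by exists apex; apply/eqP.
case=> [i|].
  have [j ->|->] := unliftP ord0 i.
    by rewrite laplacian_leaf !fl /f /=; field.
  rewrite laplacian_center.
  have -> : \sum_(j < d) (f center - f (leaf j)) =
      u *+ d - (u *+ d + S * v) / y%:C.
    rewrite sumrB sumr_const card_ord -mulr_suml big_split /= sumr_const.
    by rewrite card_ord -mulr_suml.
  by rewrite /f eqxx eliminate_leaves // -AE.
rewrite laplacian_apex.
have -> : \sum_(j < d) (f apex - (a (lift ord0 j))^-1 * f (leaf j)) =
    v *+ d - (S^* * u + v *+ d) / y%:C.
  rewrite sumrB sumr_const card_ord; congr (_ - _).
  rewrite /S rmorph_sum mulr_suml -[v *+ d](_ : \sum_(j < d) v = _); last first.
    by rewrite sumr_const card_ord.
  rewrite -big_split mulr_suml; apply: eq_bigr => j _ /=.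
  have aJ := unit_conjE (a1 (lift ord0 j)); rewrite [X in _ = (X * u + v) / _]aJ.
  have aj := unit_neq0 (a1 (lift ord0 j)).
  by field; rewrite yC0 aj.
have BJ : (B y)^* = (a ord0)^-1 * y%:C + S^*.
  rewrite /B rmorphD rmorphM; congr (_ * _ + _); first exact: unit_conjE.
  exact: conjc_real.
by rewrite [S^* * u + _]addrC /f eqxx eliminate_leaves // -AE -BJ.
Qed.

(** * The magneto-spectral height *)

Lemma lambda1_star_gauge_le1 a l : (forall j, `|a j| = 1) ->
  is_lambda1 (star_gauge a) l -> l <= 1 /\ (l = 1 -> \sum_j a j = 0).
Proof.
move=> a1 [el ml]; have [S0|S0] := eqVneq (\sum_j a j) 0.
  have [e1 _] := balanced_lambda1 a1 S0.
  by split=> //; have := ml _ e1; rewrite lecR.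
have [k k1 ek] := unbalanced_eigenvalue a1 S0.
have lk : l <= k by have := ml _ ek; rewrite lecR.
have l1 : l < 1 by apply: le_lt_trans k1.
by split; [exact: ltW|move=> l1'; rewrite l1' ltxx in l1].
Qed.

Lemma height_suspended_star :
  (0 < d)%N -> magneto_spectral_height R (suspension (star d)) = 1.
Proof.
move=> d0; have [b b1 [b0 _]] := @unit_sum0_exists R d.+1 d0.
set E := [set l : R | exists2 s, @magnetic_potential R V s & is_lambda1 s l].
have E1 : E 1.
  exists (star_gauge b); first exact: star_gauge_potential.
  exact: balanced_lambda1.
have ubE : ubound E 1.
  move=> l [s hs ls]; have [a a1 sa] := star_gauge_normal_form hs.
  by have [] := lambda1_star_gauge_le1 a1 (gauge_lambda1 sa ls).
apply/eqP; rewrite eq_le; apply/andP; split; first by apply: ge_sup => //; exists 1.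
by apply: ub_le_sup => //; exists 1.
Qed.

Lemma maximal_star_gauge a : (0 < d)%N -> (forall j, `|a j| = 1) ->
  maximal_potential (star_gauge a) <-> \sum_j a j = 0.
Proof.
move=> d0 a1; rewrite /maximal_potential height_suspended_star //; split.
  by move=> [_ /(lambda1_star_gauge_le1 a1)[_]]; apply.
by move=> a0; split; [exact: star_gauge_potential|exact: balanced_lambda1].
Qed.

Lemma gauge_maximal s t : magnetic_potential t -> gauge_equivalent s t ->
  maximal_potential s -> maximal_potential t.
Proof. by move=> ht st [_ ls]; split=> //; exact: gauge_lambda1 ls. Qed.

Lemma normalized_star_gauge s :
  magnetic_potential s -> (forall j : 'I_d, s center (leaf j) = 1) ->
  gauge_equivalent s (star_gauge (fun j => s (Some j) apex)).
Proof.
move=> hs s1; exists (fun=> 1); split=> [x|x y xy]; first exact: normr1.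
rewrite invr1 mul1r mulr1.
case: x y xy => [i|] [j|] //= xy; last by have [] := hs (Some j) apex isT.
have [_ sji] := hs (Some i) (Some j) xy.
move: xy; rewrite /star_adj.
have [i' ei|ei] := unliftP ord0 i; have [j' ej|ej] := unliftP ord0 j;
  rewrite ei ej ?eqxx ?s1 //= => _.
by move: sji; rewrite ei ej s1 => /(congr1 GRing.inv); rewrite invrK invr1.
Qed.

(** Triviality on the star forces a gauge transformation to be constant there,
    so it multiplies all the [a j] by the same number, here 1 because the first
    entries agree. *)
Lemma star_gauge_rigid a b : a ord0 != 0 -> a ord0 = b ord0 ->
  gauge_equivalent (star_gauge a) (star_gauge b) -> a =1 b.
Proof.
move=> a0 ab0 [tau [tau1 ab]].
have tau0 x := unit_neq0 (tau1 x).
have tl j : tau (leaf j) = tau center.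
  have /= := ab center (leaf j) isT; rewrite mulr1 mulrC => e.
  by rewrite -[LHS](divfK (tau0 center)) -e mul1r.
have bE j : b j = (tau center)^-1 * a j * tau apex.
  have /= -> := ab (Some j) apex isT.
  by have [i ->|->] := unliftP ord0 j; rewrite ?tl.
have tau_eq : (tau center)^-1 * tau apex = 1.
  by apply: (mulfI a0); rewrite mulr1 mulrCA mulrA [RHS]ab0 bE.
by move=> j; rewrite bE mulrAC tau_eq mul1r.
Qed.

End SuspendedStar.

(** * Uncountably many inequivalent maximal potentials *)

Lemma unit_interval_uncountable (R : realType) : ~ countable (`[0%R, 1%R] : set R).
Proof.
move/countable_lebesgue_measure0/eqP.
by rewrite lebesgue_measure_itv /= lte01 sube0 onee_eq0.
Qed.

Section Family.
Variables (R : realType) (n : nat).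

Definition circle_point (t : R) : R[i] := t +i* Num.sqrt (1 - t ^+ 2).

Lemma circle_point_unit t : 0 <= t <= 1 -> `|circle_point t| = 1.
Proof.
move=> /andP[t0 t1]; rewrite normc_def /= sqr_sqrtr.
  by rewrite addrC subrK sqrtr1.
by rewrite subr_ge0 expr_le1.
Qed.

(** The pair 1, -1 fixes the first entry, which excludes a common factor between
    two members; the balanced remainder can then be rotated freely by z. *)
Definition balanced_family (b : 'I_n.+2 -> R[i]) (z : R[i]) (j : 'I_(2 + n.+2)) :=
  match fintype.split j with
  | inl i => if i == ord0 then 1 else -1
  | inr i => z * b i
  end.

Lemma balanced_family_unit b z : (forall j, `|b j| = 1) -> `|z| = 1 ->
  forall j, `|balanced_family b z j| = 1.
Proof.
move=> b1 z1 j; rewrite /balanced_family; case: fintype.split => i.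
  by case: ifP => _; rewrite ?normrN normr1.
by rewrite normrM z1 b1 mul1r.
Qed.

Lemma balanced_family_sum b z : \sum_j b j = 0 -> \sum_j balanced_family b z j = 0.
Proof.
move=> b0; rewrite big_split_ord /= /balanced_family.
rewrite [X in X + _](_ : _ = 0); last first.
  rewrite !big_ord_recl big_ord0 addr0 !(unsplitK (inl _)) /=.
  exact: subrr.
rewrite add0r (eq_bigr (fun i => z * b i)) => [|i _].
  by rewrite -mulr_sumr b0 mulr0.
by rewrite (unsplitK (inr _)).
Qed.

(** The member of parameter t has first entry 1, and its third entry is the
    point of the upper half circle with real part t. *)
Lemma uncountable_maximal :
  exists A : set (suspension (star n.+3) -> suspension (star n.+3) -> R[i]),
    [/\ ~ countable A,
        forall s, A s -> maximal_potential s &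
        forall s1 s2, A s1 -> A s2 -> s1 <> s2 -> ~ gauge_equivalent s1 s2].
Proof.
have [b b1 [b0 b01]] := @unit_sum0_exists R n.+2 isT.
pose fam (t : R) : 'I_n.+4 -> R[i] := balanced_family b (circle_point t).
have fam0 t : fam t ord0 = 1.
  rewrite /fam /balanced_family (_ : ord0 = @lshift 2 n.+2 ord0); last exact: val_inj.
  by rewrite (unsplitK (inl _)).
have fam2 t : fam t (@rshift 2 n.+2 ord0) = circle_point t.
  by rewrite /fam /balanced_family (unsplitK (inr _)) b01 ?mulr1.
pose F (t : R) := star_gauge (fam t).
exists (F @` `[0, 1]); split.
- move=> cF; apply: (@unit_interval_uncountable R).
  move/countable_injP : cF => [g gi]; apply/countable_injP; exists (g \o F).
  move=> t t' ht ht' /= e.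
  have /(congr1 (fun f => f (Some (@rshift 2 n.+2 ord0)) None)) : F t = F t'.
    apply: gi => //; rewrite inE; [exists t|exists t'] => //.
    + by rewrite inE in ht.
    + by rewrite inE in ht'.
  by rewrite /F /= !fam2 => -[].
- move=> _ [t ht <-]; apply/maximal_star_gauge => //.
    exact/balanced_family_unit/circle_point_unit.
  exact: balanced_family_sum.
- move=> _ _ [t ht <-] [t' ht' <-] ne /star_gauge_rigid rig; apply: ne.
  by rewrite /F (funext (rig _ _)) // fam0 ?oner_neq0.
Qed.

End Family.

Theorem corollary4p13 (R : realType) (d : nat) (hd : (1 <= d)%N) :
  (forall s : suspension (star d) -> suspension (star d) -> R[i],
     magnetic_potential s ->
     (maximal_potential s <->
      exists t : suspension (star d) -> suspension (star d) -> R[i],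
        [/\ magnetic_potential t,
            gauge_equivalent s t,
            forall j : 'I_d, t (Some ord0) (Some (lift ord0 j)) = 1 &
            exists a : 'I_d.+1 -> R[i],
              [/\ forall j, `|a j| = 1,
                  forall j, t (Some j) None = a j &
                  \sum_(j < d.+1) a j = 0]])) /\
  ((3 <= d)%N ->
   exists A : set (suspension (star d) -> suspension (star d) -> R[i]),
     [/\ ~ countable A,
         forall s, A s -> maximal_potential s &
         forall s1 s2, A s1 -> A s2 -> s1 <> s2 -> ~ gauge_equivalent s1 s2]).
Proof.
split=> [s hs|]; last first.
  by case: d {hd} => [|[|[|n]]] // _; exact: uncountable_maximal.
split=> [ms|[t [ht st tl [a [a1 ta a0]]]]].
  have [a a1 sa] := star_gauge_normal_form hs.
  have ha := star_gauge_potential a1.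
  exists (star_gauge a); split=> //; exists a; split=> //.
  by apply/(maximal_star_gauge hd a1); exact: gauge_maximal ms.
have := normalized_star_gauge ht tl; rewrite (funext ta) => tg.
have gs := gauge_equivalent_sym (gauge_equivalent_trans st tg).
exact: gauge_maximal hs gs ((maximal_star_gauge hd a1).2 a0).
Qed.
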